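(* Formulation F7 is strictly tighter than Formulation F3 (both defined in the context). Explicitly: (i) for every instance $(T,M,(W_m)_{m\in M})$ and every continuous solution $(X,S)$ of F7, the component $X$ is a continuous solution of F3; and (ii) there exist an instance and a continuous solution $X$ of F3 for that instance such that there is no $S$ for which $(X,S)$ is a continuous solution of F7.
   Context: An instance of the generator maintenance scheduling problem consists of a horizon $T=\{1,2,\dots,|T|\}$ of periods, a finite nonempty set $M$ of maintenances, and a positive integer duration $W_m$ for each $m\in M$. The variables are $X_{t,m}$ (maintenance $m$ is executed in period $t$) and $S_{t,m}$ (maintenance $m$ starts in period $t$), for $t\in T$, $m\in M$. Conventions: $X_{t,m}=0$ whenever $t\le 0$ or $t>|T|$; $S_{t,m}=0$ whenever $t\le 0$, $t>|T|$, or $t\ge |T|-W_m+2$ (a maintenance cannot start so late that it would not finish within the horizon). In particular every solution involving $S$ is required to satisfy $S_{t,m}=0$ for $t\in T$ with $t\ge |T|-W_m+2$. Formulation F3 (variables $X$ only): $\sum_{t\in T}X_{t,m}=W_m$ for all $m\in M$; $X_{t,m}-X_{t-1,m}\le X_{t+W_m-1,m}$ for all $t\in T$, $m\in M$; $X_{t,m}\in\{0,1\}$ for all $t\in T$, $m\in M$. Formulation F7 (variables $X,S$): $\sum_{t\in T}S_{t,m}=1$ for all $m\in M$; $\sum_{t'=t-W_m+1}^{t}S_{t',m}=X_{t,m}$ for all $t\in T$, $m\in M$; $X_{t,m},S_{t,m}\in\{0,1\}$ for all $t\in T$, $m\in M$. A continuous solution of a formulation is a real assignment of its variables satisfying its linear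 relaxation, i.e. all its constraints with each condition ''$\in\{0,1\}$'' replaced by ''$\in[0,1]$''. A formulation A is at least as tight as B if all continuous solutions satisfying A also satisfy B; A is strictly tighter than B if A is at least as tight as B and there is at least one continuous solution satisfying B that does not satisfy A. Since F3 has only the variables $X$, the comparison is in terms of $X$: a given $X$ satisfies F7 when some $S$ completes it to a continuous solution of F7. *)

(* Defs.v *)
From mathcomp Require Import all_boot all_order all_algebra.
From mathcomp Require Import reals.

Set Implicit Arguments.
Unset Strict Implicit.
Unset Printing Implicit Defensive.
Import Order.TTheory GRing.Theory Num.Theory.
Local Open Scope ring_scope.

(** Generator maintenance scheduling: formulations F3 and F7, their linear
    relaxations, and comparison of their tightness. *)

Record instance := Instance {
  horizon : nat;
  maintenance : finType;
  maintenance_gt0 : (0 < #|maintenance|)%N;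
  duration : maintenance -> nat;
  duration_gt0 : forall m, (0 < duration m)%N
}.

(* The ordinal i : 'I_(horizon I) encodes the period i + 1 of {1, ..., |T|}. *)
Definition period n (i : 'I_n) : int := i.+1%:Z.

Definition assignment (R : realType) (I : instance) :=
  'I_(horizon I) -> maintenance I -> R.

(* Value of a variable at an arbitrary integer index t, which is 0 by
   convention when t <= 0 or t > |T|. *)
Definition at_time (R : realType) (I : instance) (x : assignment R I)
    (t : int) (m : maintenance I) : R :=
  if t is Posz k.+1 then
    if insub k is Some i then x i m else 0
  else 0.

Definition binary (R : realType) : {pred R} := [pred x | (x == 0) || (x == 1)].

Definition unit_interval (R : realType) : {pred R} := [pred x | 0 <= x <= 1].

(* Each formulation is parametrized by the domain of its variables: [binary]
   gives the formulation itself, [unit_interval] its linear relaxation. *)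

Definition F3 (R : realType) (dom : {pred R}) (I : instance)
    (X : assignment R I) : Prop :=
  [/\ forall m, \sum_t X t m = (duration m)%:R,
      forall t m, X t m - at_time X (period t - 1) m
                    <= at_time X (period t + (duration m)%:Z - 1) m
    & forall t m, X t m \in dom].

(* The index t' of the second constraint ranges over the integer interval
   [t - W_m + 1, t], written as t - W_m + 1 + j with 0 <= j < W_m. The third
   clause is the convention forbidding starts too late to finish within the
   horizon; the comparison is in int, so nothing is truncated. *)
Definition F7 (R : realType) (dom : {pred R}) (I : instance)
    (X S : assignment R I) : Prop :=
  [/\ forall m, \sum_t S t m = 1,
      forall t m, \sum_(j < duration m)
                     at_time S (period t - (duration m)%:Z + 1 + j%:Z) m
                  = X t m,
      forall t m, (horizon I)%:Z - (duration m)%:Z + 2 <= period t -> S t m = 0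
    & forall t m, (X t m \in dom) && (S t m \in dom)].

(* A criterion in terms of X selects, in each instance, assignments of X. *)
Definition criterion (R : realType) := forall I : instance, assignment R I -> Prop.

Definition F3_continuous (R : realType) : criterion R :=
  fun I X => F3 (@unit_interval R) X.

Definition F7_continuous (R : realType) : criterion R :=
  fun I X => exists S : assignment R I, F7 (@unit_interval R) X S.

Definition at_least_as_tight (R : realType) (A B : criterion R) : Prop :=
  forall (I : instance) (X : assignment R I), A I X -> B I X.

Definition strictly_tighter (R : realType) (A B : criterion R) : Prop :=
  at_least_as_tight A B /\
  exists (I : instance) (X : assignment R I), B I X /\ ~ A I X.

(* Main.v *)
Require Import Defs.
From mathcomp Require Import all_boot all_order all_algebra.
From mathcomp Require Import reals.
From mathcomp Require Import zify lra.

(** Extend [X] and [S] by zero to all integer times. The ban on late starts makes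
    the linking constraint of F7, that [X] at [t] is the sum of [S] over the window
    [t - W + 1, t], hold at every integer [t] and not only within the horizon
    ([at_time_window]). Both constraints of F3 follow. Two consecutive windows
    differ only in their end points, so the increase of [X] at [t] is at most [S]
    at [t], and this start lies in the window that ends at [t + W - 1]
    ([F7_increase]). Summing [X] over the horizon counts each permitted start [W]
    times, because the whole window following it fits in the horizon, and the
    starts sum to 1 ([F7_total]).

    The inclusion is strict: with horizon 3 and one maintenance of duration 2, the
    constant [X = 2/3] satisfies F3. In F7, the first two periods force S_1 = 2/3
    and S_2 = 0, whereas the third, where starting is forbidden, forces
    S_2 = 2/3. *)

Set Implicit Arguments.
Unset Strict Implicit.
Unset Printing Implicit Defensive.
Import Order.TTheory GRing.Theory Num.Theory.
Local Open Scope ring_scope.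

(** * Assignments extended by zero to all integer times *)

Variant time_spec n : int -> Type :=
  | TimeBefore t of t <= 0 : time_spec n t
  | TimeAfter t of n%:Z < t : time_spec n t
  | TimePeriod (i : 'I_n) : time_spec n (period i).

Lemma timeP n (t : int) : time_spec n t.
Proof.
have [t_le0|t_gt0] := lerP t 0; first exact: TimeBefore.
have [t_gtn|t_len] := ltrP n%:Z t; first exact: TimeAfter.
have lt_tn : (`|t|.-1 < n)%N by lia.
have -> : t = period (Ordinal lt_tn) by rewrite /period /=; lia.
exact: TimePeriod.
Qed.

Section AtTime.

Variables (R : realType) (I : instance) (x : assignment R I).
Variable m : maintenance I.

Lemma at_time_before t : t <= 0 -> at_time x t m = 0.
Proof. by case: t => [[|k]|k]. Qed.

Lemma at_time_after t : (horizon I)%:Z < t -> at_time x t m = 0.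
Proof.
case: t => [[|k]|k] //= lt_nk.
by rewrite insubF //; apply/negbTE; lia.
Qed.

Lemma at_time_period i : at_time x (period i) m = x i m.
Proof. by rewrite /= valK. Qed.

Lemma at_time_ge0 t : (forall i, 0 <= x i m) -> 0 <= at_time x t m.
Proof.
move=> x_ge0; case: (timeP (horizon I) t) => {}t.
- by move=> /at_time_before->.
- by move=> /at_time_after->.
- by rewrite at_time_period.
Qed.

End AtTime.

(** * Sums over windows *)

Lemma sum_shift1 (V : zmodType) (g : int -> V) (n : nat) :
  \sum_(i < n) g (i%:Z - 1) = g (- 1) + \sum_(i < n) g i%:Z - g (n%:Z - 1).
Proof.
elim: n => [|n IHn]; first by rewrite !big_ord0 addr0 sub0r subrr.
rewrite !big_ord_recr /= IHn subrK.
have -> : n.+1%:Z - 1 = n%:Z by lia.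
by rewrite addrA addrK.
Qed.

(** * F7 implies F3 *)

Section F7toF3.

Variables (R : realType) (I : instance) (X S : assignment R I).
Hypothesis F7XS : F7 (@unit_interval R) X S.
Variable m : maintenance I.

Let W := duration m.
Let n := horizon I.
Let s t := at_time S t m.

Lemma start_ge0 t : 0 <= s t.
Proof.
case: F7XS => _ _ _ dom; apply: at_time_ge0 => i.
by have /andP[_ /andP[]] := dom i m.
Qed.

Lemma start_before t : t <= 0 -> s t = 0.
Proof. exact: at_time_before. Qed.

Lemma late_start t : n%:Z - W%:Z + 2 <= t -> s t = 0.
Proof.
case: F7XS => _ _ late _; rewrite /s; case: (timeP n t) => {}t.
- by move=> /at_time_before->.
- by move=> /at_time_after->.
- by rewrite at_time_period; apply: late.
Qed.

(** Before the horizon the window meets no period; after it, the window contains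
    only times at which starting is forbidden. *)
Lemma at_time_window t :
  at_time X t m = \sum_(j < W) s (t - W%:Z + 1 + j%:Z).
Proof.
case: (timeP n t) => {}t.
- move=> t_le0; rewrite at_time_before // big1 // => j _.
  by apply: start_before; have := ltn_ord j; lia.
- move=> t_gtn; rewrite at_time_after // big1 // => j _.
  by apply: late_start; lia.
- by case: F7XS => _ link _ _; rewrite at_time_period link.
Qed.

(** The window sums at [t] and [t - 1] telescope to [s t - s (t - W)]. Dropping the
    nonnegative [s (t - W)] leaves [s t], the first term of the window that ends at
    [t + W - 1]. *)
Lemma F7_increase t :
  at_time X t m - at_time X (t - 1) m <= at_time X (t + W%:Z - 1) m.
Proof.
have W_gt0 : (0 < W)%N := duration_gt0 m.
have start_le : s t <= at_time X (t + W%:Z - 1) m.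
  rewrite at_time_window (bigD1 (Ordinal W_gt0)) //=.
  have -> : t + W%:Z - 1 - W%:Z + 1 + 0 = t by lia.
  by rewrite lerDl sumr_ge0 // => j _; exact: start_ge0.
apply: le_trans start_le.
have step := sum_shift1 (fun z => s (t - W%:Z + 1 + z)) W.
have prevE : at_time X (t - 1) m =
    \sum_(j < W) s (t - W%:Z + 1 + (j%:Z - 1)).
  by rewrite at_time_window; apply: eq_bigr => j _; congr s; lia.
rewrite prevE step at_time_window.
have -> : t - W%:Z + 1 + (W%:Z - 1) = t by lia.
have := start_ge0 (t - W%:Z + 1 - 1).
lra.
Qed.

(** Delaying every start by [k < W] periods loses nothing at the end of the
    horizon, since the last [W - 1] periods contain no start, and gains nothing
    at its beginning. *)
Lemma sum_delayed_start k :
  (k < W)%N -> \sum_(i < n) s (period i - k%:Z) = 1.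
Proof.
elim: k => [|k IHk] lt_kW.
  case: F7XS => total _ _ _; rewrite -(total m).
  by apply: eq_bigr => i _; rewrite subr0 /s at_time_period.
rewrite -(IHk (ltnW lt_kW)).
have := sum_shift1 (fun z => s (z + 1 - k%:Z)) n.
rewrite start_before; last lia.
rewrite late_start; last lia.
rewrite add0r subr0 => shift.
rewrite (eq_bigr (fun i : 'I_n => s (i%:Z - 1 + 1 - k%:Z))); last first.
  by move=> i _; congr s; rewrite /period; lia.
by rewrite shift; apply: eq_bigr => i _; congr s; rewrite /period; lia.
Qed.

(** The term of index [j] of the window is the start delayed by [W - 1 - j] periods,
    so exchanging the two sums leaves [W] sums of delayed starts, each equal to 1. *)
Lemma F7_total : \sum_t X t m = W%:R.
Proof.
case: F7XS => _ link _ _.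
under eq_bigr do rewrite -link.
rewrite exchange_big /= (eq_bigr (fun=> 1)).
  by rewrite sumr_const card_ord.
move=> j _; rewrite -(sum_delayed_start (k := W - j.+1)); last first.
  by have := ltn_ord j; rewrite -/W; lia.
apply: eq_bigr => i _; rewrite /s; congr at_time.
by move: (period i) => t; have := ltn_ord j; lia.
Qed.

End F7toF3.

Lemma F7_F3_continuous (R : realType) :
  at_least_as_tight (@F7_continuous R) (@F3_continuous R).
Proof.
move=> I X [S F7XS]; split=> [m|t m|t m].
- exact: F7_total F7XS m.
- by rewrite -(at_time_period X); exact: F7_increase F7XS m _.
- by case: F7XS => _ _ _ /(_ t m)/andP[].
Qed.

(** * An F3 solution that F7 excludes *)

Lemma card_unit_gt0 : (0 < #|{: unit}|)%N.
Proof. by rewrite card_unit. Qed.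

Definition one_maintenance_3_2 : instance :=
  @Instance 3 unit card_unit_gt0 (fun=> 2%N) (fun=> isT).

Definition two_thirds (R : realType) : assignment R one_maintenance_3_2 :=
  fun _ _ => 2 / 3.

Lemma two_thirds_F3 (R : realType) : F3_continuous (two_thirds R).
Proof.
split=> [m|t m|t m].
- by rewrite sumr_const card_ord /two_thirds -[_ *+ _]mulr_natr /=; lra.
- have X_ge0 z : 0 <= at_time (two_thirds R) z m.
    by apply: at_time_ge0 => i; rewrite /two_thirds; lra.
  have [t0|t_neq0] := eqVneq t ord0.
    (* In the first period the right-hand side is the value in period 2. *)
    rewrite t0 at_time_before //.
    have -> : period (ord0 : 'I_3) + 2%:Z - 1 = period (lift ord0 ord0 : 'I_3).
      by [].
    by rewrite at_time_period /two_thirds; lra.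
  (* Later, [X] does not increase. *)
  apply: le_trans (X_ge0 _).
  have t_gt0 : (0 < t)%N by rewrite lt0n.
  have lt_t3 : (t < 3)%N := ltn_ord t.
  have -> : period t - 1 = period (inord t.-1 : 'I_3).
    by rewrite /period inordK; lia.
  by rewrite at_time_period /two_thirds subrr.
- by rewrite inE /two_thirds; lra.
Qed.

Lemma two_thirds_not_F7 (R : realType) : ~ F7_continuous (two_thirds R).
Proof.
case=> S [_ link late _].
pose i0 : 'I_3 := ord0; pose i1 : 'I_3 := lift ord0 ord0; pose i2 : 'I_3 := ord_max.
have window (i : 'I_3) : at_time S (period i - 1) tt + S i tt = 2 / 3.
  have := link i tt.
  rewrite !big_ord_recl big_ord0 !addr0 /two_thirds => <-.
  rewrite -(at_time_period S tt i); move: (period i) => t; rewrite /= /bump /=.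
  by congr (_ + _); congr at_time; lia.
have S1 := window i0; rewrite at_time_before // in S1.
have S2 := window i1.
have prev1 : period i1 - 1 = period i0 by [].
rewrite prev1 at_time_period in S2.
have S3 := window i2.
have prev2 : period i2 - 1 = period i1 by [].
have no_start : S i2 tt = 0 by apply: late.
rewrite prev2 at_time_period no_start in S3.
lra.
Qed.

Theorem corollary3p2 (R : realType) :
  strictly_tighter (@F7_continuous R) (@F3_continuous R).
Proof.
split; first exact: F7_F3_continuous.
exists one_maintenance_3_2, (two_thirds R).
by split; [exact: two_thirds_F3 | exact: two_thirds_not_F7].
Qed.
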